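(* Let $q=c/d>1$ be a rational number with $c,d$ relatively prime positive integers. For $1\leq i\leq d$ let $a_i\in\{1,\ldots,c\}$ with $a_i\equiv d^{-1}(c-d-1+i)\pmod c$, and for $0\leq m\leq c-d-1$ let $b_m\in\{1,\ldots,c\}$ with $b_m\equiv d^{-1}m-1\pmod c$ (where $d^{-1}$ is the inverse of $d$ modulo $c$). Then $$A(x)=\frac{\sum_{i=1}^d x^{1+a_i+\left\lfloor\frac{a_i}{q}\right\rfloor}}{1-x^{c+d}},\quad B(x)=\frac{\sum_{i=1}^d x^{2+a_i+\left\lfloor\frac{a_i}{q}\right\rfloor}}{1-x^{c+d}},\quad C(x)=\frac{\sum_{i=2}^{c+1}x^{i+\left\lfloor\frac{i}{q}\right\rfloor}}{1-x^{c+d}},$$ and, for $1\leq i\leq\lceil q\rceil-1$, $$D_i(x)=\frac{\sum_{m=0}^{c-1-di}x^{1+b_m+\left\lfloor\frac{b_m+1}{q}\right\rfloor}}{1-x^{c+d}}.$$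
   Context: A binary word is $q$-decreasing if every maximal factor $0^a1^b$ satisfies $a=0$ or $qa>b$. Let $\mathcal{F}$ be the set of words $0^a1^b$ with $a,b\geq1$ and $1+\lfloor b/q\rfloor\leq a\leq 1+\lfloor (b+1)/q\rfloor$. Define subsets of $\mathcal{F}$: $\mathtt{C}$ = the words $0^a1^b\in\mathcal{F}$ such that $0^a1^{b+1}$ is $q$-decreasing; $\mathtt{A}=\mathcal{F}\setminus\mathtt{C}$; $\mathtt{B}$ = the words $0^a1^b\in\mathcal{F}$ with $a\geq2$ such that $0^{a-1}1^b$ is $q$-decreasing; for $1\leq i\leq\lceil q\rceil-1$, $\mathtt{D}_i$ = the words $0^a1^b\in\mathcal{F}$ such that $0^a1^{b+i+1}$ is $q$-decreasing. $A(x),B(x),C(x),D_i(x)$ are the generating functions of $\mathtt{A},\mathtt{B},\mathtt{C},\mathtt{D}_i$ respectively, where $0^a1^b$ has weight $x^{a+b}$. *)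

(* Defs.v *)
From mathcomp Require Import all_boot all_order all_algebra.
From mathcomp Require Import boolp classical_sets.

Set Implicit Arguments.
Unset Strict Implicit.
Unset Printing Implicit Defensive.

Import Order.TTheory GRing.Theory Num.Theory.
Local Open Scope ring_scope.
Local Open Scope classical_set_scope.

(* Binary words: [false] is the letter 0 and [true] is the letter 1.          *)
Definition word := seq bool.

Definition block (a b : nat) : word := nseq a false ++ nseq b true.

(* [u] and [v] locate the occurrence of the factor 0^a 1^b in [w]; it is      *)
(* maximal when no occurrence of a factor 0^a' 1^b' strictly contains it.     *)
Definition maximal_block (w u : word) (a b : nat) (v : word) : Prop :=
  w = u ++ block a b ++ v /\
  forall (u' v' : word) (a' b' : nat), w = u' ++ block a' b' ++ v' ->
    (size u' <= size u)%N -> (size v' <= size v)%N ->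
    size u' = size u /\ size v' = size v.

Definition q_decreasing (q : rat) (w : word) : Prop :=
  forall (u v : word) (a b : nat), maximal_block w u a b v ->
    a = 0%N \/ q * a%:R > b%:R.

(* [Num.truncn x] is the floor of x, as a natural number, for x >= 0.         *)
Definition langF (q : rat) : set word :=
  [set w | exists a b : nat,
    [/\ w = block a b, (1 <= a)%N, (1 <= b)%N &
        (1 + Num.truncn (b%:R / q) <= a <= 1 + Num.truncn ((b + 1)%:R / q))%N]].

Definition langC (q : rat) : set word :=
  [set w | langF q w /\
    exists a b : nat, w = block a b /\ q_decreasing q (block a (b + 1))].

Definition langA (q : rat) : set word := langF q `\` langC q.

Definition langB (q : rat) : set word :=
  [set w | langF q w /\
    exists a b : nat,
      [/\ w = block a b, (2 <= a)%N & q_decreasing q (block (a - 1) b)]].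

Definition langD (q : rat) (i : nat) : set word :=
  [set w | langF q w /\
    exists a b : nat, w = block a b /\ q_decreasing q (block a (b + i + 1))].

(* Formal power series, as sequences of coefficients.                         *)
Definition fps (R : Type) := nat -> R.

Definition fps_of_poly (R : comUnitRingType) (p : {poly R}) : fps R :=
  fun n => p`_n.

Definition fps_mul (R : comUnitRingType) (f g : fps R) : fps R :=
  fun n => \sum_(k < n.+1) f k * g (n - k)%N.

(* First n coefficients of the quotient f / g, obtained by solving            *)
(* fps_mul (f / g) g = f degree by degree; meaningful when g 0 is a unit      *)
(* (see fps_divK).                                                            *)
Fixpoint fps_div_coefs (R : comUnitRingType) (f g : fps R) (n : nat) : seq R :=
  if n is m.+1 then
    let s := fps_div_coefs f g m in
    rcons s ((f m - \sum_(k < m) s`_k * g (m - k)%N) / g 0%N)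
  else [::].

Definition fps_div (R : comUnitRingType) (f g : fps R) : fps R :=
  fun n => (fps_div_coefs f g n.+1)`_n.

Lemma size_fps_div_coefs (R : comUnitRingType) (f g : fps R) n :
  size (fps_div_coefs f g n) = n.
Proof. by elim: n => //= n IH; rewrite size_rcons IH. Qed.

Lemma nth_fps_div_coefs (R : comUnitRingType) (f g : fps R) n k :
  (k < n)%N -> (fps_div_coefs f g n)`_k = fps_div f g k.
Proof.
elim: n => // n IH; rewrite ltnS leq_eqVlt => /orP[/eqP -> //|ltkn].
by rewrite /= nth_rcons size_fps_div_coefs ltkn IH.
Qed.

Lemma fps_divE (R : comUnitRingType) (f g : fps R) n :
  fps_div f g n = (f n - \sum_(k < n) fps_div f g k * g (n - k)%N) / g 0%N.
Proof.
rewrite {1}/fps_div /= nth_rcons size_fps_div_coefs ltnn eqxx.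
by under eq_bigr do rewrite nth_fps_div_coefs //.
Qed.

Lemma fps_divK (R : comUnitRingType) (f g : fps R) :
  g 0%N \is a GRing.unit -> fps_mul (fps_div f g) g = f.
Proof.
move=> ug; apply: funext => n.
by rewrite /fps_mul big_ord_recr /= subnn fps_divE divrK // addrC subrK.
Qed.

Lemma fps_mulK (R : comUnitRingType) (f g : fps R) :
  g 0%N \is a GRing.unit -> fps_div (fps_mul f g) g = f.
Proof.
move=> ug; apply: funext => n; elim/ltn_ind: n => n IH.
rewrite fps_divE /fps_mul big_ord_recr /= subnn.
under [X in _ - X]eq_bigr do rewrite IH //.
by rewrite [X in X - _]addrC addrK mulrK.
Qed.

(* The weight x^(a + b) of the word 0^a 1^b is x to the length of that word.  *)
Definition genfun (L : set word) : fps int :=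
  fun n => #|[pred w : n.-tuple bool | `[< L (tval w) >]]|%:R.

Definition ratfun (N D : {poly int}) : fps int :=
  fps_div (fps_of_poly N) (fps_of_poly D).

(* Main.v *)
(* For a, b >= 1 the word 0^a 1^b is q-decreasing iff b d < a c, and q > 1     *)
(* makes floor((b+1)/q) exceed floor(b/q) by at most 1. Hence each of the four *)
(* languages contains at most one word for each number b of ones: it has the   *)
(* shape { 0^(h b) 1^b | b >= 1, P b }, where P only depends on b d mod c (or  *)
(* (b+1) d mod c) and h (b + c) = h b + d. Replacing b by b + c multiplies the *)
(* weight by x^(c+d), so the generating function is the sum over 1 <= b <= c   *)
(* divided by 1 - x^(c+d). As d is invertible modulo c, this sum can be        *)
(* indexed by the residue, which yields the numbers a_i and b_m.               *)

Require Import Defs.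
From mathcomp Require Import all_boot all_order all_algebra.
From mathcomp Require Import boolp.
From mathcomp Require Import zify.
Set Implicit Arguments.
Unset Strict Implicit.
Unset Printing Implicit Defensive.

Import Order.TTheory GRing.Theory Num.Theory.
Local Open Scope ring_scope.

(** For fixed b, the words 0^a 1^b of F are those with floor(bd/c) < a <= 1 + floor((b+1)d/c). This
    leaves one value of a, or two when bd mod c >= c - d. C takes the largest value for every b; A
    the smaller and B the larger whenever there are two; D_i the largest when (b+1)d mod c < c - di
    ([langC_block], [langA_block], [langB_block], [langD_block]). [genfun_periodic] reduces the
    series to the sum over one period, [big_residues] indexes that sum by residues, and
    [modn_of_inverse] recognizes a_i and b_m as the preimages of the residues c - d - 1 + i and
    m. *)

Lemma size_block a b : size (block a b) = (a + b)%N.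
Proof. by rewrite size_cat !size_nseq. Qed.

Lemma count_block a b : count id (block a b) = b.
Proof. by rewrite count_cat !count_nseq mul0n mul1n. Qed.

Lemma block_inj a b a' b' : block a b = block a' b' -> a = a' /\ b = b'.
Proof.
move=> E; have Eb : b = b' by rewrite -(count_block a b) E count_block.
split=> //; have := congr1 size E; rewrite !size_block Eb; exact: addIn.
Qed.

(** The only maximal block of a block is the word itself: compared with the whole word, the contexts
    [u] and [v] of a maximal occurrence must be empty. *)
Lemma q_decreasing_block q a b :
  q_decreasing q (block a b) <-> a = 0%N \/ q * a%:R > b%:R.
Proof.
have whole : block a b = [::] ++ block a b ++ [::] by rewrite cats0.
split=> [|qab u v a' b' [E maxE]].
  by apply; split=> [|u' v' ? ? _ /=]; [exact: whole | rewrite !leqn0 => /eqP-> /eqP->].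
have [/esym/size0nil u0 /esym/size0nil v0] := maxE _ _ _ _ whole isT isT.
by move: E; rewrite u0 v0 cats0 => /block_inj[<- <-].
Qed.

Lemma truncn_divq (c d n : nat) :
  (0 < c)%N -> (0 < d)%N ->
  Num.truncn (n%:R / (c%:R / d%:R) : rat) = (n * d %/ c)%N.
Proof.
move=> c0 d0; have c0R : (0 : rat) < c%:R by rewrite ltr0n.
apply: truncn_def; rewrite invf_div mulrA -natrM ler_pdivlMr // ltr_pdivrMr //.
by rewrite -!natrM ler_nat ltr_nat leq_divM ltn_ceil.
Qed.

Lemma ltq_nat (c d a b : nat) : (0 < d)%N ->
  ((b%:R : rat) < c%:R / d%:R * a%:R) = (b * d < a * c)%N.
Proof.
move=> d0; have d0R : (0 : rat) < d%:R by rewrite ltr0n.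
by rewrite mulrAC ltr_pdivlMr // -!natrM ltr_nat mulnC [X in _ = (_ < X)%N]mulnC mulnC.
Qed.

(** * Generating functions of families with one word per number of ones *)

Definition block_family (P : pred nat) (h : nat -> nat) (w : word) : Prop :=
  exists b, [/\ (0 < b)%N, P b & w = block (h b) b].

(** A block with [b] ones has length at least [b], so every cutoff [N] above [n] gives the same sum.
    Leaving [N] free lets coefficients of different degrees be compared over one range. *)
Lemma genfun_block_family L P h n N :
  (forall w, L w <-> block_family P h w) -> (n < N)%N ->
  genfun L n = \sum_(1 <= b < N | P b) ((b + h b)%N == n)%:R.
Proof.
move=> LE ltnN.
pose Q := [pred b | [&& 0 < b, P b & (b + h b)%N == n]%N].
pose g (b : nat) := [tuple nth false (block (h b) b) i | i < n].
have gE b : Q b -> tval (g b) = block (h b) b.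
  move=> /and3P[_ _ /eqP bn].
  have sz : size (block (h b) b) = n by rewrite size_block addnC.
  apply: (@eq_from_nth _ false); rewrite size_tuple ?sz // => i lt_in.
  by rewrite -[i]/(val (Ordinal lt_in)) -tnth_nth tnth_mktuple.
have -> : \sum_(1 <= b < N | P b) ((b + h b)%N == n)%:R
        = #|[set b : 'I_N | Q b]|%:R :> int.
  rewrite -sum1_card natr_sum big_geq_mkord big_mkcond [RHS]big_mkcond /=.
  apply: eq_bigr => b _; rewrite inE /=.
  by case: (P b); case: (0 < b)%N; case: eqP.
have g_inj : {in [set b : 'I_N | Q b] &, injective (fun b : 'I_N => g b)}.
  move=> b b'; rewrite !inE => Qb Qb' /(congr1 val).
  by rewrite [val _]gE // [RHS]gE // => /block_inj[_ /val_inj].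
rewrite -(card_in_imset g_inj); congr (_%:R); apply: eq_card => w.
rewrite inE; apply/asboolP/imsetP => [/LE[b [b0 Pb wE]]|[b]].
  have bn : (b + h b)%N = n by rewrite addnC -size_block -wE size_tuple.
  have ltbN : (b < N)%N by apply: leq_ltn_trans ltnN; rewrite -bn leq_addr.
  have Qb : Q b by rewrite /= b0 Pb bn eqxx.
  exists (Ordinal ltbN); first by rewrite inE.
  by apply: val_inj; rewrite [RHS]gE.
rewrite inE => Qb ->; rewrite gE //; apply/LE; exists b.
by case/and3P: Qb.
Qed.

(** The recurrence says that the product of [f] with 1 - X^e is [N]. The division is exact because
    the constant coefficient is 1, as [e] is positive. *)
Lemma eq_ratfun (f : fps int) (N : {poly int}) (e : nat) : (0 < e)%N ->
  (forall n, f n = N`_n + (if (e <= n)%N then f (n - e)%N else 0)) ->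
  f = ratfun N (1 - 'X^e).
Proof.
move=> e0 fE.
have De k : fps_of_poly (1 - 'X^e : {poly int}) k
          = (k == 0%N)%:R - (k == e)%:R.
  by rewrite /fps_of_poly coefB coef1 coefXn.
have D0 : fps_of_poly (1 - 'X^e : {poly int}) 0%N = 1.
  by rewrite De eqxx ltn_eqF ?subr0.
rewrite -[LHS](@fps_mulK _ f (fps_of_poly (1 - 'X^e : {poly int}))) ?D0 ?unitr1 //.
congr fps_div; apply: funext => n; rewrite /fps_mul.
under eq_bigr => k _ do rewrite De mulrBr.
rewrite sumrB big_ord_recr /= subnn eqxx mulr1 big1 ?add0r => [|k _]; last first.
  by rewrite subn_eq0 leqNgt ltn_ord mulr0.
rewrite {1}fE -addrA -[RHS]addr0; congr (_ + _); apply/eqP; rewrite subr_eq0; apply/eqP.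
(* In the convolution with X^e only the term k = n - e survives, and it exists only for e <= n. *)
case: leqP => [le_en|lt_ne].
  have lt_n : (n - e < n.+1)%N by rewrite ltnS leq_subr.
  rewrite (bigD1 (Ordinal lt_n)) //= subKn // eqxx mulr1 big1 ?addr0 // => k.
  rewrite -val_eqE /= => ne; case: eqP => [E|]; last by rewrite mulr0.
  by case/eqP: ne; rewrite -E subKn // -ltnS.
rewrite big1 // => k _; case: eqP => [E|]; last by rewrite mulr0.
by move: lt_ne; rewrite -E ltnNge leq_subr.
Qed.

Lemma genfun_periodic L (P : pred nat) (h : nat -> nat) (c d : nat) : (0 < c)%N ->
  (forall w, L w <-> block_family P h w) ->
  (forall b, (0 < b)%N -> P (b + c)%N = P b) ->
  (forall b, (0 < b)%N -> h (b + c)%N = (h b + d)%N) ->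
  genfun L = ratfun (\sum_(1 <= b < c.+1 | P b) 'X^(b + h b)) (1 - 'X^(c + d)).
Proof.
move=> c0 LE Pc hc; apply: eq_ratfun => [|n]; first by rewrite addn_gt0 c0.
(* With this cutoff, removing the first period and shifting by [c] leaves exactly the range 1 <= b <
   n + 1. *)
rewrite (genfun_block_family (N := n.+1 + c) LE) ?ltn_addr //.
rewrite (big_cat_nat (n := c.+1)) //=; last by rewrite addSn ltnS leq_addl.
congr (_ + _).
  by rewrite coef_sum; apply: eq_bigr => b _; rewrite coefXn eq_sym.
rewrite -[c.+1]add1n big_addn addnK big_nat_cond.
rewrite [LHS](eq_bigl (fun b => (1 <= b < n.+1)%N && P b));
  last by move=> b; rewrite /=; case: ltnP => //= /Pc->.
rewrite -big_nat_cond.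
have shift b : (0 < b)%N -> (b + c + h (b + c)%N)%N = (b + h b + (c + d))%N.
  by move=> /hc->; rewrite addnACA.
case: leqP => [le_n|lt_n]; last first.
  rewrite big_nat_cond big1 // => b /andP[/andP[b0 _] _]; rewrite shift //.
  by case: eqP => // E; move: lt_n; rewrite -E ltnNge leq_addl.
rewrite (genfun_block_family (N := n.+1) LE) ?ltnS ?leq_subr //.
rewrite big_nat_cond [RHS]big_nat_cond; apply: eq_bigr => b /andP[/andP[b0 _] _].
by rewrite shift // -(eqn_add2r (c + d) (b + h b)) subnK.
Qed.

(** * Summing over a window of residues modulo c *)

Section Residues.
Variables (c d : nat).
Hypotheses (c0 : (0 < c)%N) (cop : coprime c d).

Lemma eqn_modMr_coprime x y : ((x * d) %% c == (y * d) %% c)%N = ((x %% c) == (y %% c))%N.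
Proof.
wlog le_yx : x y / (y <= x)%N.
  by move=> W; case/orP: (leq_total y x) => /W // E; rewrite eq_sym E eq_sym.
by rewrite !eqn_mod_dvd ?leq_mul2r ?le_yx ?orbT // -mulnBl Gauss_dvdl.
Qed.

Lemma eqn_mod_range x y : (0 < x <= c)%N -> (0 < y <= c)%N -> x = y %[mod c] -> x = y.
Proof.
wlog le_yx : x y / (y <= x)%N.
  by move=> W; case/orP: (leq_total y x) => /W // H ? ? /esym E; apply/esym/H.
move=> /andP[_ xc] /andP[y0 _] /eqP; rewrite eqn_mod_dvd // => /dvdn_leq.
lia.
Qed.

(** Since [d] is invertible modulo [c], b -> (b + e)d mod c is injective on 1..c, so [f] lists the
    preimages of the window without repetition. It is used with [e] = 0 for A and B, and [e] = 1 for
    D_i. *)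
Lemma big_residues (f : nat -> nat) (e o n : nat) (F : nat -> {poly int}) :
  (forall k, (k < n)%N -> (0 < f k <= c)%N /\ ((f k + e) * d %% c)%N = (o + k)%N) ->
  \sum_(1 <= b < c.+1 | (o <= (b + e) * d %% c < o + n)%N) F b
    = \sum_(0 <= k < n) F (f k).
Proof.
move=> fP; rewrite -[RHS](big_map f xpredT) -[LHS]big_filter; apply: perm_big.
apply: uniq_perm.
- by rewrite filter_uniq ?iota_uniq.
- rewrite map_inj_in_uniq ?iota_uniq // => k l; rewrite !mem_index_iota.
  move=> /fP[_ fk] /fP[_ fl] E.
  by apply: (@addnI o); rewrite -fk -fl E.
move=> b; rewrite mem_filter mem_index_iota; apply/andP/mapP => [[/andP[lo hi] bc]|[k]].
  exists ((b + e) * d %% c - o)%N; first by rewrite mem_index_iota; lia.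
  have ltn : ((b + e) * d %% c - o < n)%N by lia.
  have [fc /eqP] := fP _ ltn; rewrite subnKC // eqn_modMr_coprime eqn_modDr.
  by move=> /eqP/eqn_mod_range -> //; lia.
rewrite mem_index_iota => /= ltkn ->; have [fc ->] := fP _ ltkn; lia.
Qed.

End Residues.

(** * The four languages as families of blocks *)

Section Slope.
Variables (c d : nat) (q : rat).
Hypotheses (c0 : (0 < c)%N) (d0 : (0 < d)%N) (dc : (d < c)%N).
Hypothesis qE : q = c%:R / d%:R.

Lemma q_decreasing_slope a b : (0 < a)%N ->
  q_decreasing q (block a b) <-> (b * d < a * c)%N.
Proof.
move=> a0; rewrite q_decreasing_block qE ltq_nat //.
by split=> [[E|]//|]; [rewrite E in a0 | right].
Qed.

Lemma langF_block a b : langF q (block a b) <->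
  (0 < b)%N /\ (b * d %/ c < a <= 1 + (b + 1) * d %/ c)%N.
Proof.
split=> [[a' [b' [/block_inj[<- <-] _ b0]]]|[b0 ab]].
  by rewrite qE !truncn_divq // add1n.
exists a, b; split=> //; first by case/andP: ab => /(leq_trans _)->.
by rewrite qE !truncn_divq // add1n.
Qed.

Lemma langFP w : langF q w -> exists a b, w = block a b.
Proof. by case=> a [b [-> _ _ _]]; exists a, b. Qed.

Lemma family_block (L : word -> Prop) (P : pred nat) (h : nat -> nat) :
  (forall w, L w -> langF q w) ->
  (forall a b, L (block a b) <-> [/\ (0 < b)%N, P b & a = h b]) ->
  forall w, L w <-> block_family P h w.
Proof.
move=> LF LE w; split=> [Lw|[b [b0 Pb ->]]]; last exact/LE.
have [a [b wE]] := langFP (LF _ Lw); move: Lw; rewrite wE => /LE[b0 Pb ->].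
by exists b.
Qed.

(** As d < c, adding [d] to bd crosses at most one multiple of [c], and does so exactly when the
    residue is at least c - d. *)
Lemma divn_step b :
  ((b + 1) * d %/ c = b * d %/ c + (c - d <= b * d %% c))%N.
Proof.
rewrite mulnDl mul1n divnD // (divn_small dc) (modn_small dc) addn0.
by congr (_ + nat_of_bool _)%N; lia.
Qed.

(** The slope condition for b + 1 ones reads a > floor((b+1)d/c), which meets the upper bound of F
    in a single value. *)
Lemma langC_block a b :
  langC q (block a b) <-> [/\ (0 < b)%N, true & a = (1 + (b + 1) * d %/ c)%N].
Proof.
split=> [[/langF_block[b0 /andP[lo hi]]] [a' [b' [/block_inj[<- <-]]]]|[b0 _ aE]].
  have a0 : (0 < a)%N by apply: leq_ltn_trans lo.
  by move=> /(q_decreasing_slope _ a0); rewrite -ltn_divLR //; split=> //; lia.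
have a0 : (0 < a)%N by rewrite aE.
split; first by apply/langF_block; split=> //; rewrite aE divn_step; lia.
by exists a, b; split=> //; apply/q_decreasing_slope; rewrite // -ltn_divLR // aE.
Qed.

Lemma langA_block a b : langA q (block a b) <->
  [/\ (0 < b)%N, (c - d <= b * d %% c)%N & a = (1 + b * d %/ c)%N].
Proof.
split=> [[/langF_block[b0]]|[b0 rb aE]].
  rewrite langC_block divn_step => ab nC.
  have ne : a <> (1 + (b * d %/ c + (c - d <= b * d %% c)))%N by move=> aE; apply: nC.
  by move: ab ne; case: (c - d <= _)%N; split=> //; lia.
split; first by apply/langF_block; rewrite divn_step rb aE; split=> //; lia.
by rewrite langC_block divn_step rb => -[_ _]; lia.
Qed.

Lemma langB_block a b : langB q (block a b) <->
  [/\ (0 < b)%N, (c - d <= b * d %% c)%N & a = (2 + b * d %/ c)%N].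
Proof.
split=> [[/langF_block[b0 ab]] [a' [b' [/block_inj[<- <-] a2]]]|[b0 rb aE]].
  have a1 : (0 < a - 1)%N by lia.
  move=> /(q_decreasing_slope _ a1); rewrite -ltn_divLR //.
  by move: ab; rewrite divn_step; case: (c - d <= _)%N; split=> //; lia.
split; first by apply/langF_block; rewrite divn_step rb aE; split=> //; lia.
exists a, b; split=> //; first by rewrite aE.
by apply/q_decreasing_slope; rewrite ?aE // -ltn_divLR //; lia.
Qed.

Lemma langD_block i a b : langD q i (block a b) <->
  [/\ (0 < b)%N, ((b + 1) * d %% c < c - d * i)%N & a = (1 + (b + 1) * d %/ c)%N].
Proof.
(* Dividing (b+1)d by [c] with remainder r, both sides say r + di < c; the truncated subtraction is
   harmless, both being false when di >= c. *)
have slopeE : ((b + i + 1) * d < (1 + (b + 1) * d %/ c) * c)%N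
            = ((b + 1) * d %% c < c - d * i)%N.
  have -> : ((b + i + 1) * d = (b + 1) * d + d * i)%N by lia.
  rewrite {1}(divn_eq ((b + 1) * d) c) mulnDl mul1n.
  by move: (_ %/ _)%N (_ %% _)%N (d * i)%N => Q r s; lia.
split=> [[/langF_block[b0 /andP[lo hi]]] [a' [b' [/block_inj[<- <-]]]]|[b0 rb aE]].
  have a0 : (0 < a)%N by apply: leq_ltn_trans lo.
  move=> /(q_decreasing_slope _ a0) lt_a.
  have aE : a = (1 + (b + 1) * d %/ c)%N.
    apply/eqP; rewrite eqn_leq hi add1n ltn_divLR //.
    (* The condition for b + i + 1 ones implies the one for b + 1 ones, so [a] is the value found
       for C. *)
    by apply: leq_ltn_trans lt_a; rewrite leq_mul2r addnAC leq_addr orbT.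
  by split=> //; rewrite -slopeE -aE.
have a0 : (0 < a)%N by rewrite aE.
split; first by apply/langF_block; split=> //; rewrite aE divn_step; lia.
by exists a, b; split=> //; apply/q_decreasing_slope; rewrite // aE slopeE.
Qed.

End Slope.

(** Adding [e] and multiplying by [d] cancels [dinv]; y < c makes [y] the actual remainder. This
    moves the integer congruences defining a_i and b_m to natural numbers. *)
Lemma modn_of_inverse (c d n e y : nat) (dinv : int) :
  (d%:Z * dinv = 1 %[mod c%:Z])%Z ->
  (n%:Z = dinv * y%:Z - e%:Z %[mod c%:Z])%Z -> (y < c)%N ->
  ((n + e) * d %% c)%N = y.
Proof.
move=> dK nE yc; apply/eqP; rewrite -(modn_small yc).
rewrite -eqz_nat -!modz_nat PoszM PoszD; apply/eqP.
rewrite -modzMml -modzDml nE modzDml modzMml subrK mulrAC [dinv * _]mulrC.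
by rewrite -modzMml dK modzMml mul1r.
Qed.

Theorem mainTheorem13 (c d : nat) (q : rat) (dinv : int) (a b : nat -> nat)
    (hc : (0 < c)%N) (hd : (0 < d)%N) (hcd : coprime c d)
    (hq : q = c%:R / d%:R) (hq1 : 1 < q)
    (hdinv : (d%:Z * dinv = 1 %[mod c%:Z])%Z)
    (ha : forall i : nat, (1 <= i <= d)%N ->
       (1 <= a i <= c)%N /\
       ((a i)%:Z = dinv * (c%:Z - d%:Z - 1 + i%:Z) %[mod c%:Z])%Z)
    (hb : forall m : nat, m%:Z <= c%:Z - d%:Z - 1 ->
       (1 <= b m <= c)%N /\
       ((b m)%:Z = dinv * m%:Z - 1 %[mod c%:Z])%Z) :
  [/\ genfun (langA q) =
        ratfun (\sum_(1 <= i < d.+1)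
                   'X^(1 + a i + Num.truncn ((a i)%:R / q)))
               (1 - 'X^(c + d)),
      genfun (langB q) =
        ratfun (\sum_(1 <= i < d.+1)
                   'X^(2 + a i + Num.truncn ((a i)%:R / q)))
               (1 - 'X^(c + d)),
      genfun (langC q) =
        ratfun (\sum_(2 <= i < c.+2) 'X^(i + Num.truncn (i%:R / q)))
               (1 - 'X^(c + d))
    & forall i : nat, (1 <= i)%N -> i%:Z <= Num.ceil q - 1 ->
      genfun (langD q i) =
        ratfun (\sum_(0 <= m < (c - 1 - d * i).+1)
                   'X^(1 + b m + Num.truncn ((b m + 1)%:R / q)))
               (1 - 'X^(c + d))].
Proof.
have dc : (d < c)%N.
  by move: hq1; rewrite hq ltr_pdivlMr ?ltr0n // mul1r ltr_nat.
have langCF w : langC q w -> langF q w by case.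
have langAF w : langA q w -> langF q w by case.
have langBF w : langB q w -> langF q w by case.
have langDF i w : langD q i w -> langF q w by case.
have a_res k : (k < d)%N ->
    (0 < a k.+1 <= c)%N /\ ((a k.+1 + 0) * d %% c)%N = (c - d + k)%N.
  move=> ltkd; have [ac aE] := ha k.+1 ltkd; split=> //.
  apply: (modn_of_inverse hdinv) => //; last by lia.
  by rewrite subr0 aE; congr (_ %% _)%Z; congr (_ * _); lia.
have perR x : ((x + c) * d %% c = x * d %% c)%N.
  by rewrite mulnDl addnC [(c * d)%N]mulnC modnMDl.
have perQ x : ((x + c) * d %/ c = x * d %/ c + d)%N.
  by rewrite mulnDl [(c * d)%N]mulnC divnDMl.
have famA := family_block langAF (langA_block hc hd dc hq).
have famB := family_block langBF (langB_block hc hd dc hq).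
have famC := family_block langCF (langC_block hc hd dc hq).
have famD i := family_block (@langDF i) (langD_block hc hd dc hq i).
(* The upper end c - d + d of the window is [c], so it excludes no residue. *)
have windowA (x : nat) : (c - d <= x * d %% c)%N = (c - d <= (x + 0) * d %% c < c - d + d)%N.
  by rewrite addn0 subnK ?ltn_pmod ?andbT // ltnW.
split=> [|||i i1 iq].
- rewrite (genfun_periodic (d := d) hc famA) => [|x _|x _]; last 2 first.
  + by rewrite perR.
  + by rewrite perQ addnA.
  congr ratfun; rewrite (eq_bigl _ _ windowA) [RHS]big_add1 /=.
  rewrite (big_residues hc hcd (f := fun k => a k.+1) _ a_res).
  by apply: eq_bigr => k _; rewrite hq truncn_divq //; congr ('X^ _); lia.
- rewrite (genfun_periodic (d := d) hc famB) => [|x _|x _]; last 2 first.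
  + by rewrite perR.
  + by rewrite perQ addnA.
  congr ratfun; rewrite (eq_bigl _ _ windowA) [RHS]big_add1 /=.
  rewrite (big_residues hc hcd (f := fun k => a k.+1) _ a_res).
  by apply: eq_bigr => k _; rewrite hq truncn_divq //; congr ('X^ _); lia.
- rewrite (genfun_periodic (d := d) hc famC) => [|x _|x _] //; last first.
    by rewrite [(x + c + 1)%N]addnAC perQ addnA.
  (* The index of the stated sum is b + 1, whence its range from 2 to c + 1. *)
  congr ratfun; rewrite [RHS]big_add1 /=.
  by apply: eq_bigr => k _; rewrite hq truncn_divq // addn1; congr ('X^ _); lia.
(* i <= ceil(q) - 1 means i < q = c/d. This makes c - di positive, so that it is the number of terms
   in the stated sum. *)
have di : (d * i < c)%N.
  have iq' : i%:Z%:~R < q.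
    by rewrite -ceil_gt_int -lezD1 -lerBrDr.
  by move: iq'; rewrite hq ltr_pdivlMr ?ltr0n // -natrM ltr_nat mulnC.
have b_res k : (k < c - d * i)%N ->
    (0 < b k <= c)%N /\ ((b k + 1) * d %% c)%N = (0 + k)%N.
  (* As i >= 1, the indices k < c - di stay within the range k <= c - d - 1 where [b k] is
     specified. *)
  move=> ltk; have dik : (d <= d * i)%N by rewrite leq_pmulr.
  have [|bc bE] := hb k; first by lia.
  by split=> //; apply: (modn_of_inverse hdinv) => //; lia.
rewrite (genfun_periodic (d := d) hc (famD i)) => [|x _|x _]; last 2 first.
- by rewrite [(x + c + 1)%N]addnAC perR.
- by rewrite [(x + c + 1)%N]addnAC perQ addnA.
have -> : (c - 1 - d * i).+1 = (c - d * i)%N by lia.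
congr ratfun; rewrite (big_residues hc hcd (o := 0) _ b_res).
by apply: eq_bigr => k _; rewrite hq truncn_divq //; congr ('X^ _); lia.
Qed.
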